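(* Let $\mathrm{cl}$ be a coding length on subsets of $\mathcal I=\{1,\ldots,p\}$, with associated coding complexity $c(\cdot)$. Suppose that the entries of $X\in\mathbb R^{n\times p}$ are iid standard Gaussian $N(0,1)$. Let $s>0$, $t>0$ and $\delta\in(0,1)$, and suppose \[ n\ge \frac{8}{\delta^2}\left[\ln 3+t+s\ln(1+8/\delta)\right]. \] Then with probability at least $1-e^{-t}$, the random matrix $X$ satisfies \[ (1-\delta)\|\bar\beta\|_2\le \frac{1}{\sqrt n}\|X\bar\beta\|_2\le (1+\delta)\|\bar\beta\|_2 \] simultaneously for all vectors $\bar\beta\in\mathbb R^p$ with coding complexity $c(\bar\beta)\le s$.
   Context: Let $\mathcal I=\{1,\ldots,p\}$. A function $\mathrm{cl}$ from subsets of $\mathcal I$ to $[0,\infty]$ is a coding length if $\sum_{F\subset\mathcal I,\,F\ne\emptyset}2^{-\mathrm{cl}(F)}\le 1$, with $\mathrm{cl}(\emptyset)=0$. The coding complexity of $F\subset\mathcal I$ is $c(F)=|F|+\mathrm{cl}(F)$, and for $\beta\in\mathbb R^p$, $c(\beta)=\min\{c(F): \mathrm{supp}(\beta)\subset F\}$, where $\mathrm{supp}(\beta)=\{j:\beta_j\neq 0\}$. *)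

(* Defs.v *)
From HB Require Import structures.
From mathcomp Require Import all_boot all_order all_algebra.
From mathcomp Require Import all_classical all_reals all_analysis.
Set Implicit Arguments. Unset Strict Implicit. Unset Printing Implicit Defensive.
Import Order.TTheory GRing.Theory Num.Theory.
Local Open Scope classical_set_scope.
Local Open Scope ring_scope.

Definition pow2neg {R : realType} (x : \bar R) : R :=
  match x with
  | EFin r => 2 `^ (- r)
  | +oo%E => 0
  | -oo%E => 0 (* irrelevant: coding lengths are nonnegative *)
  end.

Definition coding_length {R : realType} (p : nat) (cl : {set 'I_p} -> \bar R) : Prop :=
  (forall F, (0 <= cl F)%E) /\ cl finset.set0 = 0%E /\
  \sum_(F : {set 'I_p} | F != finset.set0) pow2neg (cl F) <= 1.

Definition cc_set {R : realType} (p : nat) (cl : {set 'I_p} -> \bar R) (F : {set 'I_p}) : \bar R :=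
  ((#|F|%:R : R)%:E + cl F)%E.

Definition supp {R : realType} (p : nat) (b : 'I_p -> R) : {set 'I_p} :=
  [set j | b j != 0].

Definition cc_vec {R : realType} (p : nat) (cl : {set 'I_p} -> \bar R) (b : 'I_p -> R) : \bar R :=
  \big[Order.min/+oo%E]_(F : {set 'I_p} | supp b \subset F) cc_set cl F.

Definition norm2 {R : realType} (m : nat) (v : 'I_m -> R) : R :=
  Num.sqrt (\sum_(i < m) v i ^+ 2).

Definition matvec {R : realType} (n p : nat) (X : 'I_n -> 'I_p -> R) (b : 'I_p -> R) : 'I_n -> R :=
  fun i => \sum_(j < p) X i j * b j.

(* mutual independence of a finite family of real random variables:
   product rule for every choice of measurable sets (taking B k = setT gives
   every subfamily). *)
Definition mutually_independent {d} {T : measurableType d} {R : realType}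
  (P : probability T R) (I : finType) (Y : I -> {RV P >-> R}) : Prop :=
  forall B : I -> set R, (forall k, measurable (B k)) ->
    P (\bigcap_(k in [set: I]) (Y k @^-1` B k)) = (\prod_(k : I) P (Y k @^-1` B k))%E.

Definition std_gaussian {d} {T : measurableType d} {R : realType}
  (P : probability T R) (Y : {RV P >-> R}) : Prop :=
  forall B : set R, measurable B -> P (Y @^-1` B) = normal_prob 0 1 B.

(* Main.v *)
Require Import Defs.
From HB Require Import structures.
From mathcomp Require Import all_boot all_order all_algebra.
From mathcomp Require Import all_classical all_reals all_analysis.
From mathcomp Require Import measurable_realfun ring lra.
Import Order.TTheory GRing.Theory Num.Theory.
Local Open Scope classical_set_scope.
Local Open Scope ring_scope.
Set Implicit Arguments. Unset Strict Implicit. Unset Printing Implicit Defensive.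

(** For a fixed vector b, the entries of X b / |b| are independent standard
  Gaussians, so the exponential moments of |X b|^2 / |b|^2 are explicit and
  Chernoff's bound gives P(||X b| / (sqrt n |b|) - 1| > u) <= 2 exp(- n u^2 / 2).
  For a fixed support F with k = |F|, the unit sphere of R^F is discretized by
  the lattice points of mesh eps / sqrt k obtained by rounding coordinates
  towards 0. Such a point has l1-norm at most k / eps in lattice units, so
  weighting the lattice by (1 + eps)^(- l1-norm) shows that there are at most
  (2 e (1 + 1 / eps))^k of them; no volume argument is needed. With
  eps = delta / 12 and u = 3 delta / 4 the net estimate extends to all of R^F,
  and the union bound over nets costs at most exp(-t) 2^(- cl F) for each F of
  complexity at most s. Summing over F gives exp(-t). *)

(** * Independence extended from pi-systems, and Tonelli for independent variables *)

Section independence.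
Local Open Scope ereal_scope.
Context d (T : measurableType d) (R : realType) (P : probability T R).

(** For fixed [B], both [P (A & B)] and [P A * P B] are finite measures in [A]; agreeing on a
    pi-system, they agree on the sigma-algebra it generates. Applied once in each argument. *)
Lemma pi_system_independence (G H : set (set T)) :
  G `<=` measurable -> H `<=` measurable ->
  setI_closed G -> setI_closed H -> G setT -> H setT ->
  (forall A B, G A -> H B -> P (A `&` B) = P A * P B) ->
  forall A B, <<s G >> A -> <<s H >> B -> P (A `&` B) = P A * P B.
Proof.
move=> mG mH GI HI GT HT GH.
have half (G' : set (set T)) B : G' `<=` measurable -> setI_closed G' ->
    G' setT -> measurable B -> (forall A, G' A -> P (A `&` B) = P A * P B) ->
    forall A, <<s G' >> A -> P (A `&` B) = P A * P B.
  move=> mG' G'I G'T mB G'B A sA.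
  have pB0 : (0 <= fine (P B))%R by rewrite fine_ge0.
  have pBE : ((NngNum pB0)%:num%:E = P B) by rewrite /= fineK// fin_num_measure.
  have := @g_sigma_algebra_measure_unique _ R T G' mG' (fun=> setT) (fun=> G'T) _
    (mrestr P mB) (mscale (NngNum pB0) P) G'I _ _ A sA.
  rewrite /= /mrestr /mscale pBE muleC; apply.
  - by rewrite bigcup_const//; exists 0%N.
  - by move=> C G'C; rewrite G'B// muleC.
  - by move=> _; rewrite (le_lt_trans (probability_le1 _ _)) ?ltry//; exact: measurableI.
have sm (G' : set (set T)) : G' `<=` measurable -> <<s G' >> `<=` measurable.
  by move=> mG'; apply: smallest_sub => //; exact: sigma_algebra_measurable.
move=> A B sA sB.
rewrite setIC muleC; apply: (half H) => //; first exact: sm sA.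
move=> {sB}B HB; rewrite setIC muleC; apply: (half G) => //; first exact: mH.
by move=> {sA}A GA; exact: GH.
Qed.

(** The law of the pair agrees with the product of the two laws on rectangles, hence everywhere, and
    Tonelli applies. *)
Lemma indep_integral d1 d2 (T1 : measurableType d1) (T2 : measurableType d2)
    (U : {mfun T >-> T1}) (V : {mfun T >-> T2}) (h : T1 * T2 -> \bar R) :
  (forall A B, measurable A -> measurable B ->
    P (U @^-1` A `&` V @^-1` B) = P (U @^-1` A) * P (V @^-1` B)) ->
  measurable_fun setT h -> (forall z, 0 <= h z) ->
  \int[P]_w h (U w, V w) =
  \int[distribution P U]_x \int[distribution P V]_y h (x, y).
Proof.
move=> UV mh h0.
have mUV : measurable_fun setT (fun w => (U w, V w)) by exact: measurable_fun_pair.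
rewrite -[RHS](@fubini_tonelli1 _ _ _ _ R (distribution P U) (distribution P V) h)//.
rewrite -[LHS](@ge0_integral_pushforward _ _ _ _ _ _ mUV P setT h)//.
apply: eq_measure_integral => A mA _ /=; symmetry.
by apply: (@product_measure_unique _ _ _ _ R (distribution P U) (distribution P V)
  (pushforward P (fun w => (U w, V w)))) => //.
Qed.

End independence.

(** * Variables depending on disjoint groups of coordinates *)

Section groups.
Context d (T : measurableType d) (R : realType) (P : probability T R).
Variables (I : finType) (X : I -> {RV P >-> R}).
Hypothesis Xindep : mutually_independent X.

(** A pi-system generating the sigma-algebra of the [X k] with [k] in [A]. Taking [B k = setT] off
    [A] keeps the intersection over all of [I], the form in which mutual independence is stated. *)
Definition cylinders (A : pred I) : set (set T) :=
  [set C | exists B : I -> set R, [/\ forall k, measurable (B k),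
    forall k, ~~ A k -> B k = setT & C = \bigcap_(k in [set: I]) (X k @^-1` B k)]].

Definition measurable_wrt (A : pred I) (U : T -> R) :=
  measurable_fun setT (U : g_sigma_algebraType (cylinders A) -> R).

Lemma cylinders_measurable A : cylinders A `<=` measurable.
Proof.
move=> _ [B [mB _ ->]]; apply: fin_bigcap_measurable => // k _.
by rewrite -[X in measurable X]setTI; exact: (measurable_funP (X k)).
Qed.

Lemma cylinders_setI A : setI_closed (cylinders A).
Proof.
move=> _ _ [B [mB AB ->]] [C [mC AC ->]].
exists (fun k => B k `&` C k); split => [k|k Ak|].
- exact: measurableI.
- by rewrite AB// AC// setIT.
- apply/seteqP; split => [w [BCw DCw] k _|w BCw].
    by split; [exact: BCw|exact: DCw].
  by split => k _; have [] := BCw k Logic.I.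
Qed.

Lemma cylinders_setT A : cylinders A setT.
Proof. by exists (fun=> setT); split => //; apply/seteqP; split. Qed.

Lemma measurable_wrt_sub (A B : pred I) U : (forall k, A k -> B k) ->
  measurable_wrt A U -> measurable_wrt B U.
Proof.
move=> AB mU _ Y mY; have := mU measurableT Y mY.
apply: smallest_sub; first exact: smallest_sigma_algebra.
move=> _ [C [mC AC ->]]; apply: sub_sigma_algebra; exists C; split => // k Bk.
by apply: AC; apply: contra Bk; exact: AB.
Qed.

Lemma measurable_wrtW A U : measurable_wrt A U -> measurable_fun setT U.
Proof.
move=> mU _ Y mY; have := mU measurableT Y mY.
apply: smallest_sub; first exact: sigma_algebra_measurable.
exact: cylinders_measurable.
Qed.

Lemma measurable_wrt_coord (A : pred I) k : A k -> measurable_wrt A (X k).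
Proof.
move=> Ak _ Y mY; rewrite setTI; apply: sub_sigma_algebra.
exists (fun l => if l == k then Y else setT); split.
- by move=> l; case: ifP.
- by move=> l Al; case: eqP => // lk; rewrite lk Ak in Al.
- apply/seteqP; split => [w Yw l _ /=|w /(_ k Logic.I)/=]; last by rewrite eqxx.
  by case: eqP => [->|].
Qed.

Lemma measurable_wrt_cst A (c : R) : measurable_wrt A (fun=> c).
Proof. by rewrite /measurable_wrt; exact: measurable_cst. Qed.

Lemma measurable_wrtD A U V : measurable_wrt A U -> measurable_wrt A V ->
  measurable_wrt A (fun w => U w + V w).
Proof. by move=> mU mV; rewrite /measurable_wrt; exact: measurable_funD. Qed.

Lemma measurable_wrt_comp A (g : R -> R) U : measurable_fun setT g ->
  measurable_wrt A U -> measurable_wrt A (fun w => g (U w)).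
Proof. by move=> mg mU; rewrite /measurable_wrt; exact: measurableT_comp. Qed.

(** It suffices to compare cylinders. At each coordinate one of the two factors is [setT], so the
    product rule for their intersections splits. *)
Lemma indep_disjoint (A B : pred I) (U V : T -> R) :
  (forall k, A k -> ~~ B k) -> measurable_wrt A U -> measurable_wrt B V ->
  forall M N, measurable M -> measurable N ->
  (P (U @^-1` M `&` V @^-1` N) = P (U @^-1` M) * P (V @^-1` N))%E.
Proof.
move=> AB mU mV M N mM mN.
apply: (@pi_system_independence _ _ _ P (cylinders A) (cylinders B)).
- exact: cylinders_measurable.
- exact: cylinders_measurable.
- exact: cylinders_setI.
- exact: cylinders_setI.
- exact: cylinders_setT.
- exact: cylinders_setT.
- move=> _ _ [C [mC AC ->]] [D [mD BD ->]].
  rewrite Xindep// Xindep// -big_split/=.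
  transitivity (P (\bigcap_(k in [set: I]) (X k @^-1` (C k `&` D k)))).
    congr (P _); apply/seteqP; split => [w [Cw Dw] k _|w CDw].
      by split; [exact: Cw|exact: Dw].
    by split => k _; have [] := CDw k Logic.I.
  rewrite Xindep => [|k]; last exact: measurableI.
  apply: eq_bigr => k _; have [Ak|Ak] := boolP (A k).
    by rewrite (BD k (AB _ Ak)) setIT preimage_setT probability_setT mule1.
  by rewrite (AC k Ak) setTI preimage_setT probability_setT mul1e.
- by have := mU measurableT M mM; rewrite setTI.
- by have := mV measurableT N mN; rewrite setTI.
Qed.

End groups.

(** * Integrals against the standard Gaussian *)

Section gaussian_integrals.
Context (R : realType).
Local Notation mu := (@lebesgue_measure R).
Local Notation N := (@normal_prob R 0 1).
Local Notation phi := (@normal_pdf R 0 1).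

Let measurable_affine (a m : R) :
  measurable_fun setT (fun x : measurableTypeR R => a * x + m : measurableTypeR R).
Proof. by apply: measurable_funD => //; exact: measurable_funM. Qed.

Lemma ge0_integral_affine (a m : R) (f : R -> \bar R) : a != 0 ->
  measurable_fun setT f -> (forall x, (0 <= f x)%E) ->
  (\int[mu]_x f (a * x + m)%R = (`|a|^-1)%:E * \int[mu]_x f x)%E.
Proof.
move=> a0 mf f0.
(* Reflection invariance of Lebesgue measure reduces negative slopes to positive ones. *)
wlog a_gt0 : a f a0 mf f0 m / 0 < a.
  have [agt0|] := ltP 0 a; first by move/(_ a f a0 mf f0 m agt0).
  rewrite le_eqVlt (negbTE a0)/= -oppr_gt0 => aN H.
  have aN0 : - a != 0 by rewrite oppr_eq0.
  rewrite -normrN -(H _ f aN0 mf f0 m aN).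
  pose g := fun x => f (a * x + m).
  rewrite -[LHS](@eq_measure_integral _ _ R setT mu
    (pushforward mu (-%R : _ -> measurableTypeR R))).
    rewrite ge0_integral_pushforward//=; last first.
      by apply: measurableT_comp => //; exact: measurable_affine.
    by apply: eq_integral => x _ /=; rewrite mulrN mulNr.
  by move=> A mA _; exact: lebesgue_measureN.
pose h : measurableTypeR R -> measurableTypeR R := fun x => a * x + m.
have mh : measurable_fun setT h by exact: measurable_affine.
rewrite gtr0_norm//.
(* By uniqueness of Lebesgue measure, checked on half-open intervals. *)
have nu A : measurable A -> mu A =
    mscale (NngNum (ltW a_gt0)) (pushforward mu h) A.
  apply: lebesgue_measure_unique => /= _ [[x y]] _ <-.
  rewrite /mscale /= /pushforward.
  rewrite (_ : h @^-1` _ = `](x - m) / a, (y - m) / a]%classic); last first.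
    apply/seteqP; split=> z /=; rewrite !in_itv/= /h ltr_pdivrMr// ler_pdivlMr//;
      by rewrite ltrBlDr lerBrDr mulrC.
  rewrite /= !lebesgue_measure_itv/= !lte_fin ltr_pM2r ?invr_gt0// ltrD2r.
  case: ifP => _; last by rewrite mule0.
  by rewrite -!EFinD -EFinM -mulrBl opprB addrA subrK mulrC divfK ?gt_eqF.
rewrite -[X in (_ * X)%E](@eq_measure_integral _ _ R setT mu
  (mscale (NngNum (ltW a_gt0)) (pushforward mu h))).
  rewrite ge0_integral_mscale//= ge0_integral_pushforward//=.
  by rewrite muleA -EFinM mulVf ?gt_eqF// mul1e.
by move=> A mA _; apply/esym/nu.
Qed.

(** The Radon-Nikodym derivative of [N] and the density [phi] have equal integrals over all
    measurable sets, so they coincide almost everywhere. *)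
Lemma ge0_integral_std_normal (f : R -> \bar R) :
  measurable_fun setT f -> (forall x, (0 <= f x)%E) ->
  (\int[N]_x f x = \int[mu]_x (f x * (phi x)%:E))%E.
Proof.
move=> mf f0.
have dom : N `<< mu by exact: normal_prob_dominates.
rewrite -(Radon_Nikodym_SigmaFinite.change_of_variables dom)//.
apply: ge0_ae_eq_integral => //.
- apply: emeasurable_funM => //.
  exact: measurable_int (Radon_Nikodym_SigmaFinite.f_integrable dom).
- by apply: emeasurable_funM => //; apply/measurable_EFinP; exact: measurable_normal_pdf.
- by move=> x _; rewrite mule_ge0// Radon_Nikodym_SigmaFinite.f_ge0.
- by move=> x _; rewrite mule_ge0// lee_fin normal_pdf_ge0.
apply: ae_eqe_mul2l; apply: integral_ae_eq => //.
- exact: Radon_Nikodym_SigmaFinite.f_integrable.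
- by apply/measurable_EFinP; exact: measurable_normal_pdf.
- by move=> E _ mE; rewrite -Radon_Nikodym_SigmaFinite.f_integral.
Qed.

Lemma std_normal_pdfE x : phi x = normal_peak 1 * expR (- x ^+ 2 / 2).
Proof. by rewrite normal_pdfE ?oner_neq0// /normal_fun subr0 expr1n. Qed.

Let mphi : measurable_fun setT (fun x => (phi x)%:E).
Proof. by apply/measurable_EFinP; exact: measurable_normal_pdf. Qed.

Let phi0 x : (0 <= (phi x)%:E)%E.
Proof. by rewrite lee_fin normal_pdf_ge0. Qed.

(** The chi-square moment generating function [(1 - 2 l)^(-1/2)], parametrized by
    [l = (1 - sigma^-2) / 2] so that its value is just [sigma]. *)
Lemma std_normal_expR_sqr (sigma : R) : 0 < sigma ->
  (\int[N]_x (expR ((1 - sigma ^- 2) / 2 * x ^+ 2))%:E = sigma%:E)%E.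
Proof.
move=> s0; rewrite ge0_integral_std_normal.
- under eq_integral => x _.
    rewrite -EFinM std_normal_pdfE mulrCA -expRD.
    (* The exponents combine into that of [phi (x / sigma)]; the added 0 matches the affine change
       of variables. *)
    rewrite [X in expR X](_ : _ = - (sigma^-1 * x + 0) ^+ 2 / 2); last first.
      by field; rewrite gt_eqF.
    rewrite -std_normal_pdfE; over.
  rewrite (@ge0_integral_affine _ _ (fun x => (phi x)%:E))//.
    by rewrite integral_normal_pdf mule1 gtr0_norm ?invrK// invr_gt0.
  by rewrite invr_eq0 gt_eqF.
- apply/measurable_EFinP/measurableT_comp => //; apply: measurable_funM => //.
- by move=> x; rewrite lee_fin expR_ge0.
Qed.

(** Stability of the Gaussian: [a N + b N'] has the law of [c N]. Substitute [w = a x + b y],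
    exchange the integrals, and integrate [y] out. *)
Lemma std_normal_convolution (a b c : R) (f : R -> \bar R) :
  a != 0 -> 0 < c -> c ^+ 2 = a ^+ 2 + b ^+ 2 ->
  measurable_fun setT f -> (forall x, (0 <= f x)%E) ->
  (\int[N]_y \int[N]_x f (a * x + b * y)%R = \int[N]_x f (c * x)%R)%E.
Proof.
move=> a0 c0 cab mf f0.
have ac0 : 0 < `|a| by rewrite normr_gt0.
have mk : measurable_fun setT (fun z : measurableTypeR R * measurableTypeR R =>
    (phi ((z.2 - b * z.1) / a) * phi z.1)%:E).
  apply/measurable_EFinP; apply: measurable_funM.
    apply: (measurableT_comp (measurable_normal_pdf 0 1)).
    by apply: measurable_funM => //; apply: measurable_funB => //; apply: measurable_funM.
  by apply: (measurableT_comp (measurable_normal_pdf 0 1)).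
have mh : measurable_fun setT (fun z : measurableTypeR R * measurableTypeR R =>
   (f z.2 * (phi ((z.2 - b * z.1) / a) * phi z.1)%:E)%E).
  by apply: emeasurable_funM => //; apply: (measurableT_comp mf).
have mf2 : measurable_fun setT (fun z : measurableTypeR R * measurableTypeR R =>
   (f (a * z.2 + b * z.1)%R)%E).
  apply: (measurableT_comp mf); apply: measurable_funD; exact: measurable_funM.
have mf2y y : measurable_fun setT (fun x => f (a * x + b * y)).
  apply: (measurableT_comp mf); apply: measurable_funD => //; exact: measurable_funM.
have inner y : (\int[N]_x f (a * x + b * y)%R * (phi y)%:E =
   (`|a|^-1)%:E * \int[mu]_w (f w * (phi ((w - b * y) / a) * phi y)%:E))%E.
  have mg : measurable_fun setT (fun w => f w * (phi ((w - b * y) / a))%:E)%E.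
    apply: emeasurable_funM => //; apply/measurable_EFinP.
    apply: (measurableT_comp (measurable_normal_pdf 0 1)).
    by apply: measurable_funM => //; apply: measurable_funB.
  have g0 w : (0 <= f w * (phi ((w - b * y) / a))%:E)%E by rewrite mule_ge0.
  under [in RHS]eq_integral do rewrite EFinM muleA.
  rewrite ge0_integralZr// muleA; congr (_ * _)%E.
  rewrite ge0_integral_std_normal//.
  rewrite -(ge0_integral_affine (b * y) a0 mg g0).
  by apply: eq_integral => x _; rewrite addrK mulrAC divff// mul1r.
rewrite ge0_integral_std_normal//; last 2 first.
  - apply: (@measurable_fun_fubini_tonelli_F _ _ (measurableTypeR R) (measurableTypeR R) R N _ mf2).
    by move=> z.
  - by move=> y; apply: integral_ge0.
under eq_integral do rewrite inner.
rewrite ge0_integralZl//; last 2 first.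
  - apply: (@measurable_fun_fubini_tonelli_F _ _ (measurableTypeR R) (measurableTypeR R) R mu _ mh).
    by move=> z; rewrite mule_ge0// EFinM mule_ge0.
  - by move=> y _; apply: integral_ge0 => w _; rewrite mule_ge0// EFinM mule_ge0.
rewrite (fubini_tonelli (fun z : measurableTypeR R * measurableTypeR R =>
   (f z.2 * (phi ((z.2 - b * z.1) / a) * phi z.1)%:E)%E))//; last first.
  by move=> z; rewrite mule_ge0// EFinM mule_ge0.
rewrite /=.
have A2 : `|a| ^+ 2 = a ^+ 2 by rewrite real_normK// num_real.
(* Completing the square in y, using a^2 + b^2 = c^2. *)
have square w y : phi ((w - b * y) / a) * phi y =
    phi (w / c) * phi (c / `|a| * y + - (b * w) / (c * `|a|)).
  rewrite !std_normal_pdfE mulrACA -expRD [RHS]mulrACA -expRD; congr (_ * expR _).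
  rewrite expr_div_n -A2; apply/eqP; rewrite -subr_eq0.
  rewrite [X in X == _](_ : _ = (c ^+ 2 - `|a| ^+ 2 - b ^+ 2) * (c ^+ 2 * y ^+ 2 - w ^+ 2)
    / (2 * `|a| ^+ 2 * c ^+ 2)).
    by rewrite cab A2 (addrC (a ^+ 2)) addrK subrr !mul0r.
  by field; rewrite !gt_eqF.
have mix w : measurable_fun setT (fun y => (phi (c / `|a| * y + - (b * w) / (c * `|a|)))%:E).
  apply/measurable_EFinP/(measurableT_comp (measurable_normal_pdf 0 1)).
  exact: measurable_affine.
have mfc : measurable_fun setT (fun w => f w * (phi (w / c))%:E)%E.
  apply: emeasurable_funM => //; apply/measurable_EFinP.
  by apply: (measurableT_comp (measurable_normal_pdf 0 1)); exact: measurable_funM.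
have fc0 w : (0 <= f w * (phi (w / c))%:E)%E by rewrite mule_ge0.
(* After completing the square, the factor depending on [y] is a shifted and rescaled density, of
   integral [|a| / c]. *)
have outer w : (\int[mu]_y (f w * (phi ((w - b * y) / a) * phi y)%:E) =
    (`|a| / c)%:E * (f w * (phi (w / c))%:E))%E.
  under eq_integral do rewrite square EFinM muleA.
  rewrite ge0_integralZl//; last exact: mix.
  rewrite [LHS]muleC; congr (_ * _)%E.
  rewrite (@ge0_integral_affine _ _ (fun x => (phi x)%:E))//; last first.
    by rewrite mulf_neq0 ?invr_eq0 ?gt_eqF.
  rewrite integral_normal_pdf mule1 gtr0_norm ?divr_gt0//.
  by rewrite invf_div.
under eq_integral do rewrite outer.
rewrite ge0_integralZl//; last by rewrite lee_fin divr_ge0// ltW.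
rewrite muleA -EFinM mulrA mulVf ?gt_eqF// mul1r.
rewrite [RHS]ge0_integral_std_normal//; last first.
  by apply: (measurableT_comp mf); exact: measurable_funM.
(* The remaining substitution is [w = c x]. *)
have := @ge0_integral_affine c 0 _ (lt0r_neq0 c0) mfc fc0.
rewrite gtr0_norm// => <-; apply: eq_integral => x _.
by rewrite addr0 mulrAC divff ?gt_eqF// mul1r.
Qed.
End gaussian_integrals.

(** * Sums over independent families *)

Section gaussian_families.
Context d (T : measurableType d) (R : realType) (P : probability T R).
Variables (I : finType) (X : I -> {RV P >-> R}).
Hypothesis Xindep : mutually_independent X.
Local Notation N := (@normal_prob R 0 1).

(** The integrals against the two laws are pulled back to [P], so independence reads as two separate
    sample points [w] and [w']. *)
Lemma integral_indep_disjoint (A B : pred I) (U V : T -> R)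
    (h : measurableTypeR R * measurableTypeR R -> \bar R) :
  (forall k, A k -> ~~ B k) -> measurable_wrt X A U -> measurable_wrt X B V ->
  measurable_fun setT h -> (forall z, (0 <= h z)%E) ->
  (\int[P]_w h (U w, V w) = \int[P]_w \int[P]_w' h (U w, V w'))%E.
Proof.
move=> AB mU mV mh h0.
have mU' := measurable_wrtW mU; have mV' := measurable_wrtW mV.
pose Um := isMeasurableFun.Build _ _ _ (measurableTypeR R) U mU'.
pose Vm := isMeasurableFun.Build _ _ _ (measurableTypeR R) V mV'.
pose U' : {mfun T >-> measurableTypeR R} := HB.pack U Um.
pose V' : {mfun T >-> measurableTypeR R} := HB.pack V Vm.
rewrite (@indep_integral _ _ _ P _ _ _ _ U' V' h)//; last first.
  exact: (indep_disjoint Xindep AB mU mV).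
rewrite ge0_integral_distribution//; last 2 first.
- exact: measurable_fun_fubini_tonelli_F.
- by move=> x; apply: integral_ge0.
apply: eq_integral => w _ /=.
by rewrite ge0_integral_distribution//; exact: measurable_fun_pair2.
Qed.

Lemma integral_expR_sum (K : eqType) (A : K -> pred I) (U : K -> T -> R)
    (r : seq K) (m : R) : uniq r ->
  (forall i j k, A i k -> A j k -> i = j) ->
  (forall i, measurable_wrt X (A i) (U i)) ->
  (forall i, (\int[P]_w (expR (U i w))%:E = m%:E)%E) ->
  (\int[P]_w (expR (\sum_(i <- r) U i w))%:E = (m ^+ size r)%:E)%E.
Proof.
move=> ur Adisj mU Em.
(* The induction also carries which coordinates the partial sum depends on; the next group is
   disjoint from them, so the expectation factors. *)
suff : measurable_wrt X (fun k => has (A^~ k) r) (fun w => \sum_(i <- r) U i w) /\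
    (\int[P]_w (expR (\sum_(i <- r) U i w))%:E = (m ^+ size r)%:E)%E by case.
elim: r ur => [_|i r IH /= /andP[ir /IH[mS ES]]].
  split.
    rewrite (_ : (fun w : T => _) = cst 0); first exact: measurable_wrt_cst.
    by apply/funext => w; rewrite big_nil.
  under eq_integral do rewrite big_nil expR0.
  by rewrite integral_cst// mul1e; exact: probability_setT.
have mUi : measurable_wrt X (fun k => A i k) (U i) by exact: mU.
split.
  rewrite (_ : (fun w : T => _) = (fun w => U i w + \sum_(j <- r) U j w)); last first.
    by apply/funext => w; rewrite big_cons.
  apply: measurable_wrtD.
    by apply: measurable_wrt_sub mUi => k ->.
  by apply: measurable_wrt_sub mS => k ->; rewrite orbT.
under eq_integral do rewrite big_cons expRD EFinM.
rewrite (@integral_indep_disjoint (A i) (fun k => has (A^~ k) r) (U i) _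
  (fun z => (expR z.1)%:E * (expR z.2)%:E)%E)//=; last 2 first.
- move=> k Aik; apply/hasPn => j jr; apply: contra ir => Ajk.
  by rewrite (Adisj i j k).
- by apply: emeasurable_funM; apply/measurable_EFinP; exact: measurableT_comp.
have mexp (V : T -> R) : measurable_fun setT V ->
    measurable_fun setT (fun w => (expR (V w))%:E).
  by move=> mV; apply/measurable_EFinP; exact: measurableT_comp.
have mUT := measurable_wrtW mUi; have mST := measurable_wrtW mS.
under eq_integral => w _.
  rewrite ge0_integralZl ?lee_fin ?expR_ge0//; last exact: mexp.
  rewrite ES; over.
rewrite ge0_integralZr//; last 2 first.
- exact: mexp.
- by rewrite -ES; apply: integral_ge0 => w _; rewrite lee_fin expR_ge0.
by rewrite Em -EFinM exprS.
Qed.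

(* Only c^2 is specified: the law of c N does not depend on the sign of c. *)
Lemma sum_gaussian (b : I -> R) (r : seq I) : uniq r ->
  (forall k, std_gaussian (X k)) ->
  measurable_wrt X (mem r) (fun w => \sum_(k <- r) b k * X k w) /\
  exists2 c : R, c ^+ 2 = \sum_(k <- r) b k ^+ 2 &
  forall f : R -> \bar R, measurable_fun setT f -> (forall x, (0 <= f x)%E) ->
    (\int[P]_w f (\sum_(k <- r) b k * X k w)%R = \int[N]_x f (c * x)%R)%E.
Proof.
move=> ur gX; elim: r ur => [_|k r IH /= /andP[kr /IH[mS [a a2 Ea]]]].
  split.
    rewrite (_ : (fun w : T => _) = cst 0); first exact: measurable_wrt_cst.
    by apply/funext => w; rewrite big_nil.
  exists 0 => [|f mf f0]; first by rewrite big_nil expr0n.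
  under eq_integral do rewrite big_nil.
  under [RHS]eq_integral do rewrite mul0r.
  by rewrite !integral_cst//; congr (_ * _)%E; rewrite [LHS]probability_setT [RHS]probability_setT.
have mX : measurable_wrt X (pred1 k) (X k).
  by apply: measurable_wrt_coord; rewrite /= eqxx.
split.
  rewrite (_ : (fun w : T => _) = (fun w => b k * X k w +
    \sum_(l <- r) b l * X l w)); last first.
    by apply/funext => w; rewrite big_cons.
  apply: measurable_wrtD.
    apply: measurable_funM; first exact: measurable_wrt_cst.
    by apply: measurable_wrt_sub mX => l /=; rewrite inE => ->.
  by apply: measurable_wrt_sub mS => l /=; rewrite inE => ->; rewrite orbT.
have EX (g : R -> \bar R) : measurable_fun setT g -> (forall x, (0 <= g x)%E) ->
    (\int[P]_w g (X k w) = \int[N]_x g x)%E.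
  move=> mg g0.
  (* Lebesgue measure lives on [measurableTypeR R], whose display differs from the
     default one of [R], hence the cast of [X k]. *)
  pose Xm := isMeasurableFun.Build _ _ _ (measurableTypeR R) (X k) (measurable_funP (X k)).
  pose X' : {mfun T >-> measurableTypeR R} := HB.pack (X k : T -> _) Xm.
  rewrite -(@ge0_integral_distribution _ _ _ _ _ P X' g)//.
  by apply: eq_measure_integral => A mA _; exact: gX.
have Esum (f : R -> \bar R) : measurable_fun setT f -> (forall x, (0 <= f x)%E) ->
    (\int[P]_w f (\sum_(l <- k :: r) b l * X l w)%R =
     \int[N]_y \int[N]_x f (a * x + b k * y)%R)%E.
  move=> mf f0.
  have mh : measurable_fun setT (fun z : measurableTypeR R * measurableTypeR R =>
      f (b k * z.1 + z.2)).
    by apply: (measurableT_comp mf); apply: measurable_funD => //; exact: measurable_funM.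
  under eq_integral do rewrite big_cons.
  rewrite (@integral_indep_disjoint (pred1 k) (mem r) (X k) _
    (fun z => f (b k * z.1 + z.2)))//=; last first.
    by move=> l /= /eqP->.
  (* With [X k] frozen, the induction hypothesis replaces the tail sum by [a N]; then the law of
     [X k] is used. *)
  under eq_integral => w _.
    rewrite (Ea (fun s => f (b k * X k w + s)))//; last first.
      by apply: (measurableT_comp mf); exact: measurable_funD.
    over.
  rewrite (EX (fun y => \int[N]_x f (b k * y + a * x)%R))%E; last 2 first.
  - apply: (@measurable_fun_fubini_tonelli_F _ _ (measurableTypeR R)
      (measurableTypeR R) R N (fun z => f (b k * z.1 + a * z.2))) => //.
    apply: (measurableT_comp mf); apply: measurable_funD => //; exact: measurable_funM.
  - by move=> y; apply: integral_ge0.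
  by apply: eq_integral => y _; apply: eq_integral => x _; rewrite addrC.
(* The convolution divides by [a], so a tail with zero variance is treated apart. *)
have [a0|a0] := eqVneq a 0.
  exists (b k) => [|f mf f0]; first by rewrite big_cons -a2 a0 expr0n addr0.
  rewrite Esum//; apply: eq_integral => y _.
  rewrite (eq_integral (cst (f (b k * y)))); last by move=> x _; rewrite a0 mul0r add0r.
  by rewrite integral_cst// [X in (_ * X)%E]probability_setT mule1.
have s0 : 0 < a ^+ 2 + b k ^+ 2.
  by rewrite ltr_pwDl ?sqr_ge0// exprn_even_gt0.
exists (Num.sqrt (a ^+ 2 + b k ^+ 2)) => [|f mf f0].
  by rewrite sqr_sqrtr ?ltW// big_cons a2 addrC.
rewrite Esum// (@std_normal_convolution _ a (b k) (Num.sqrt (a ^+ 2 + b k ^+ 2)))//.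
- by rewrite sqrtr_gt0.
- by rewrite sqr_sqrtr// ltW.
Qed.

End gaussian_families.

(** * Chi-square concentration of the norm of [X b] for a fixed [b] *)

Section norms.
Context (R : realType).

Lemma norm2_ge0 m (v : 'I_m -> R) : 0 <= norm2 v.
Proof. exact: sqrtr_ge0. Qed.

Lemma norm2_sqr m (v : 'I_m -> R) : norm2 v ^+ 2 = \sum_(i < m) v i ^+ 2.
Proof. by rewrite sqr_sqrtr// sumr_ge0// => i _; exact: sqr_ge0. Qed.

End norms.

Section chi_square_tail.
Context d (T : measurableType d) (R : realType) (P : probability T R).
Variables (n p : nat) (X : 'I_n * 'I_p -> {RV P >-> R}).
Hypotheses (Xindep : mutually_independent X) (Xgauss : forall k, std_gaussian (X k)).
Variable b : 'I_p -> R.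
Hypothesis b0 : 0 < norm2 b.
Local Notation Xb w := (matvec (fun i j => X (i, j) w) b).

Lemma measurable_sqr_norm2_matvec :
  measurable_fun setT (fun w => norm2 (Xb w) ^+ 2).
Proof.
under eq_fun do rewrite norm2_sqr.
apply: measurable_sum => i; apply: measurable_funX.
by apply: measurable_sum => j; exact: measurable_funM.
Qed.

(** The rows of [X] are disjoint groups of coordinates, and each of the [n] rows contributes one
    factor [sigma]. *)
Lemma integral_expR_norm2_matvec (sigma : R) : 0 < sigma ->
  (\int[P]_w (expR ((1 - sigma ^- 2) / 2 * (norm2 (Xb w) ^+ 2 / norm2 b ^+ 2)))%:E
   = (sigma ^+ n)%:E)%E.
Proof.
move=> s0; pose c := (1 - sigma ^- 2) / 2 / norm2 b ^+ 2.
pose row (i : 'I_n) := [seq (i, j) | j : 'I_p].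
have row_uniq i : uniq (row i) by rewrite map_inj_uniq ?enum_uniq// => j k [].
have mf : measurable_fun setT (fun s : R => c * s ^+ 2).
  by apply: measurable_funM => //; exact: measurable_funX.
have matvecE i w : Xb w i = \sum_(k <- row i) b k.2 * X k w.
  by rewrite big_map big_enum; apply: eq_bigr => j _; rewrite mulrC.
have rowP i := sum_gaussian Xindep (fun k => b k.2) (row_uniq i) Xgauss.
rewrite -[in RHS](size_enum_ord n).
have WE w : (1 - sigma ^- 2) / 2 * (norm2 (Xb w) ^+ 2 / norm2 b ^+ 2) =
    \sum_(i <- enum 'I_n) c * Xb w i ^+ 2.
  by rewrite big_enum/= -mulr_sumr -norm2_sqr /c mulrA mulrAC.
under eq_integral do rewrite WE.
apply: (integral_expR_sum Xindep (A := fun i => mem (row i))) => /=.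
- exact: enum_uniq.
- by move=> i j k /mapP[? _ ->] /mapP[? _ []].
- move=> i; have [mS _] := rowP i.
  rewrite (_ : (fun w => _) = fun w => c * (\sum_(k <- row i) b k.2 * X k w) ^+ 2).
    exact: (measurable_wrt_comp mf).
  by apply/funext => w; rewrite matvecE.
- move=> i; have [_ [a a2 Ea]] := rowP i.
  under eq_integral do rewrite matvecE.
  (* Row [i] of [X b] has the law of [a N] with [a^2 = norm2 b ^ 2], which cancels the normalization
     in [c]. *)
  rewrite (Ea (fun s => (expR (c * s ^+ 2))%:E)).
  + rewrite -[RHS](std_normal_expR_sqr s0); apply: eq_integral => x _.
    congr (expR _)%:E; rewrite exprMn a2 big_map big_enum /= -norm2_sqr /c.
    by rewrite mulrA divfK// gt_eqF// exprn_gt0.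
  + by apply/measurable_EFinP; exact: measurableT_comp.
  + by move=> x; rewrite lee_fin expR_ge0.
Qed.

(* The factor 1 - sigma^-2 has the sign of sigma - 1, so this single statement is
  the upper tail for sigma > 1 and the lower tail for sigma < 1. *)
Lemma chi_square_tail (sigma : R) : 0 < sigma ->
  (P [set w | (1 - sigma ^- 2) / 2 * (n%:R * sigma ^+ 2) <=
              (1 - sigma ^- 2) / 2 * (norm2 (Xb w) ^+ 2 / norm2 b ^+ 2)]%R <=
   (expR (- (n%:R * (sigma - 1) ^+ 2 / 2)))%:E)%E.
Proof.
move=> s0; set a := _ * (n%:R * _).
pose W w := (1 - sigma ^- 2) / 2 * (norm2 (Xb w) ^+ 2 / norm2 b ^+ 2).
have mW : measurable_fun setT W.
  apply: measurable_funM => //; apply: measurable_funM => //.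
  exact: measurable_sqr_norm2_matvec.
pose Wm := isMeasurableFun.Build _ _ _ _ W mW.
pose W' : {RV P >-> R} := HB.pack W Wm.
apply: le_trans (chernoff W' a ltr01) _.
rewrite /mmt_gen_fun unlock.
under eq_integral do rewrite /= mulr1.
rewrite integral_expR_norm2_matvec// -EFinM lee_fin mul1r.
(* Chernoff at parameter 1 leaves [sigma^n exp(- n (sigma^2 - 1) / 2)]; this bound on [sigma] turns
   the exponent into [- n (sigma - 1)^2 / 2]. *)
have sE : sigma <= expR (sigma - 1).
  by rewrite -[leLHS](subrK 1) addrC expR_ge1Dx.
apply: (@le_trans _ _ (expR (sigma - 1) ^+ n * expR (- a))).
  by rewrite ler_wpM2r ?expR_ge0// lerXn2r ?nnegrE ?expR_ge0// ltW.
rewrite -expRM_natl -expRD ler_expR /a le_eqVlt; apply/orP; left; apply/eqP.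
by field; rewrite gt_eqF.
Qed.

Definition distorts (u : R) (w : T) :=
  norm2 (Xb w) < (1 - u) * Num.sqrt n%:R * norm2 b \/
  (1 + u) * Num.sqrt n%:R * norm2 b < norm2 (Xb w).

Lemma measurable_norm2_matvec : measurable_fun setT (fun w => norm2 (Xb w)).
Proof.
have -> : (fun w => norm2 (Xb w)) = Num.sqrt \o (fun w => norm2 (Xb w) ^+ 2).
  by apply/funext => w /=; rewrite sqrtr_sqr ger0_norm// norm2_ge0.
apply: measurableT_comp measurable_sqr_norm2_matvec.
by apply: continuous_measurable_fun; exact: sqrt_continuous.
Qed.

Lemma distorts_measurable u : measurable [set w | distorts u w].
Proof.
have mN := measurable_norm2_matvec.
have -> : [set w | distorts u w] =
    (fun w => norm2 (Xb w)) @^-1` `]-oo, (1 - u) * Num.sqrt n%:R * norm2 b[ `|`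
    (fun w => norm2 (Xb w)) @^-1` `](1 + u) * Num.sqrt n%:R * norm2 b, +oo[.
  by apply/seteqP; split => w /=; rewrite !in_itv/= andbT.
by apply: measurableU; rewrite -[X in measurable X]setTI; apply: mN => //;
  exact: measurable_itv.
Qed.

(** The two failures are the tails at [sigma = 1 - u] and [sigma = 1 + u], with the same
    exponent. *)
Lemma distorts_tail u : 0 < u < 1 ->
  (P [set w | distorts u w] <= (2 * expR (- (n%:R * u ^+ 2 / 2)))%:E)%E.
Proof.
move=> /andP[u0 u1].
have mW (k : R) : measurable_fun setT (fun w => k * (norm2 (Xb w) ^+ 2 / norm2 b ^+ 2)).
  apply: measurable_funM => //; apply: measurable_funM => //.
  exact: measurable_sqr_norm2_matvec.
have mge (k a : R) : measurable [set w | a <= k * (norm2 (Xb w) ^+ 2 / norm2 b ^+ 2)].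
  rewrite (_ : [set _ | _] = (fun w => k * (norm2 (Xb w) ^+ 2 / norm2 b ^+ 2)) @^-1`
    `[a, +oo[).
    by rewrite -[X in measurable X]setTI; apply: mW => //; exact: measurable_itv.
  by apply/seteqP; split => w /=; rewrite in_itv/= andbT.
have s1 : 0 < 1 - u by rewrite subr_gt0.
have s2 : 0 < 1 + u by rewrite addr_gt0.
apply: le_trans; last first.
  rewrite mulr_natl mulr2n EFinD; apply: leeD.
    by have := chi_square_tail s1; rewrite addrAC subrr add0r sqrrN; apply.
  by have := chi_square_tail s2; rewrite addrAC subrr add0r; apply.
apply: le_trans (measureU2 P (mge _ _) (mge _ _)).
apply: le_measure; rewrite ?inE//; [exact: distorts_measurable|exact: measurableU|].
have nE : n%:R = Num.sqrt n%:R ^+ 2 :> R by rewrite sqr_sqrtr.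
have bn : norm2 b ^+ 2 != 0 by rewrite gt_eqF// exprn_gt0.
move=> w [lt|lt]; [left|right] => /=.
  (* For [sigma = 1 - u] the factor [1 - sigma^-2] is nonpositive and reverses the inequality. *)
  apply: ler_wnM2l.
    rewrite pmulr_lle0 ?invr_gt0// subr_le0 invf_ge1 ?exprn_gt0//.
    by rewrite exprn_ile1 ?(ltW s1)// lerBlDr lerDl ltW.
  rewrite ler_pdivrMr ?exprn_gt0// {1}nE mulrC -!exprMn.
  rewrite lerXn2r ?nnegrE ?norm2_ge0 ?mulr_ge0 ?sqrtr_ge0 ?norm2_ge0 ?(ltW s1)//.
  by rewrite ltW// (mulrC (norm2 b)) (mulrC (Num.sqrt _)).
apply: ler_wpM2l.
  rewrite divr_ge0// subr_ge0 invf_le1 ?exprn_gt0//.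
  by rewrite exprn_ege1// lerDl ltW.
rewrite ler_pdivlMr ?exprn_gt0// {1}nE -!exprMn.
rewrite lerXn2r ?nnegrE ?norm2_ge0 ?mulr_ge0 ?sqrtr_ge0 ?norm2_ge0 ?(ltW s2)//.
by rewrite ltW// (mulrC (Num.sqrt _)).
Qed.
End chi_square_tail.

(** * Elementary properties of the Euclidean norm *)

Section euclidean_norm.
Context (R : realType).

Lemma cauchy_schwarz (I : finType) (A : {pred I}) (a b : I -> R) :
  (\sum_(i in A) a i * b i) ^+ 2 <=
  (\sum_(i in A) a i ^+ 2) * (\sum_(i in A) b i ^+ 2).
Proof.
set S := \sum_(i in A) a i * b i; set a2 := \sum_(i in A) _; set b2 := \sum_(i in A) _.
have b2_ge0 : 0 <= b2 by apply: sumr_ge0 => i _; exact: sqr_ge0.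
have [b20|b2_neq0] := eqVneq b2 0.
  rewrite b20 mulr0 /S big1 ?expr0n// => i Ai.
  have /eqP := b20; rewrite psumr_eq0 => [/allP/(_ i)|j _]; last exact: sqr_ge0.
  by rewrite mem_index_enum Ai sqrf_eq0 => /(_ isT)/eqP->; rewrite mulr0.
(* This sum equals [b2 (a2 b2 - S^2)], and [b2] is positive here. *)
have : 0 <= \sum_(i in A) (b2 * a i - S * b i) ^+ 2.
  by apply: sumr_ge0 => i _; exact: sqr_ge0.
rewrite (eq_bigr (fun i => b2 ^+ 2 * a i ^+ 2 - b2 * S * 2 * (a i * b i) +
  S ^+ 2 * b i ^+ 2)); last by move=> i _; ring.
rewrite big_split sumrB/= -!mulr_sumr -/S -/a2 -/b2.
rewrite [X in 0 <= X](_ : _ = b2 * (a2 * b2 - S ^+ 2)); last by ring.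
by rewrite pmulr_rge0 ?subr_ge0// lt0r b2_neq0.
Qed.

Lemma norm2D m (a b : 'I_m -> R) :
  norm2 (fun i => a i + b i) <= norm2 a + norm2 b.
Proof.
rewrite -[leRHS]ger0_norm ?addr_ge0 ?norm2_ge0// -sqrtr_sqr ler_wsqrtr//.
rewrite (eq_bigr (fun i => a i ^+ 2 + 2 * (a i * b i) + b i ^+ 2)); last first.
  by move=> i _; ring.
rewrite sqrrD !norm2_sqr !big_split/= lerD2r lerD2l -mulr_sumr -[leRHS]mulr_natl ler_wpM2l//.
apply: le_trans (ler_norm _) _.
rewrite -[leRHS]ger0_norm ?mulr_ge0 ?norm2_ge0// -(ler_pXn2r (n := 2)) ?nnegrE//.
by rewrite !real_normK ?num_real// exprMn !norm2_sqr; exact: cauchy_schwarz.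
Qed.

Lemma norm2Z m (c : R) (a : 'I_m -> R) : norm2 (fun i => c * a i) = `|c| * norm2 a.
Proof.
rewrite /norm2 -sqrtr_sqr -sqrtrM ?sqr_ge0// mulr_sumr.
by under eq_bigr do rewrite exprMn.
Qed.

Lemma le_norm2 m (a b : 'I_m -> R) : (forall i, `|a i| <= `|b i|) ->
  norm2 a <= norm2 b.
Proof.
move=> ab; rewrite ler_wsqrtr// ler_sum// => i _.
by rewrite -(real_normK (num_real (a i))) -(real_normK (num_real (b i))) lerXn2r ?nnegrE.
Qed.

(** The Frobenius norm bounds the operator norm. It serves to show that the operator norm is finite
    and that [X b] vanishes when [norm2 b = 0]; its size is irrelevant. *)
Lemma norm2_matvec_le n p (X : 'I_n -> 'I_p -> R) b :
  norm2 (matvec X b) <= Num.sqrt (\sum_i \sum_j X i j ^+ 2) * norm2 b.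
Proof.
rewrite /norm2 -sqrtrM; last by do 2 (apply: sumr_ge0 => ? _); exact: sqr_ge0.
rewrite ler_wsqrtr// mulr_suml ler_sum// => i _; exact: cauchy_schwarz.
Qed.

End euclidean_norm.

Lemma expR1_le3 (R : realType) : expR 1 <= 3 :> R.
Proof.
(* exp(-1/6) >= 5/6 and (6/5)^6 < 3 *)
have h : expR (6^-1) <= 6 / 5 :> R.
  have := expR_ge1Dx (- 6^-1 : R); rewrite expRN => le.
  rewrite -[leLHS]invrK -[leRHS]invrK lef_pV2 ?posrE ?invr_gt0 ?expR_gt0 ?divr_gt0//.
  apply: le_trans le; lra.
rewrite [X in expR X](_ : _ = 6^-1 * 6%:R); last by rewrite mulVf// pnatr_eq0.
rewrite expRM_natr; apply: (@le_trans _ _ ((6 / 5) ^+ 6)); last lra.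
by rewrite lerXn2r ?nnegrE ?expR_ge0// divr_ge0.
Qed.

(** * Lattice nets for the unit sphere of a coordinate subspace *)

Section net.
Context (R : realType) (p : nat) (F : {set 'I_p}) (eps : R).
Hypothesis eps0 : 0 < eps.
Hypothesis F0 : (0 < #|F|)%N.

Definition net_radius : R := #|F|%:R / eps.

(** Each coordinate is a magnitude with a sign; a magnitude is at most the l1-norm, so bounding it
    by [net_radius] loses nothing. *)
Definition grid : finType := {ffun 'I_p -> 'I_(Num.truncn net_radius).+1 * bool}.

(* The coordinates outside F are frozen to [(ord0, false)] to make the grid count
  only the |F| relevant ones; the boolean is the sign. *)
Definition net : pred grid := fun z =>
  (z \in pffun_on (ord0, false) (mem F) predT) &&
  (\sum_(j in F) ((z j).1 : nat)%:R <= net_radius).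

Definition net_point (z : grid) : 'I_p -> R := fun j =>
  if j \in F then eps / Num.sqrt #|F|%:R * ((-1) ^+ (z j).2 * ((z j).1 : nat)%:R) else 0.

Lemma card_net : #|net|%:R <= (expR 1 * (2 * (1 + eps) / eps)) ^+ #|F|.
Proof.
have e1 : 0 < 1 + eps by rewrite addr_gt0.
(* Each z in the net satisfies 1 <= exp(k) x^(l1-norm of z), and the sum of the
  weights x^(l1-norm) over the whole grid factors over the coordinates. *)
pose x := (1 + eps)^-1.
have x0 : 0 < x by rewrite invr_gt0.
have x1 : x < 1 by rewrite invf_lt1// ltrDl.
have step : #|net|%:R <= \sum_(z | net z) (expR #|F|%:R * \prod_(j in F) x ^+ (z j).1).
  rewrite -sum1_card natr_sum ler_sum// => z /andP[_ zr].
  rewrite -ler_pdivrMr; last by apply: prodr_gt0 => j _; exact: exprn_gt0.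
  rewrite mul1r -prodfV.
  (* Since [1 / x = 1 + eps <= exp(eps)], the inverse weight is at most
     [exp(eps * net_radius) = exp(k)]. *)
  apply: (@le_trans _ _ (\prod_(j in F) expR (eps * ((z j).1 : nat)%:R))).
    apply: ler_prod => j _; rewrite invr_ge0 exprn_ge0 ?(ltW x0)//=.
    rewrite -exprVn invrK mulrC expRM_natl lerXn2r ?nnegrE ?expR_ge0 ?(ltW e1)//.
    exact: expR_ge1Dx.
  rewrite -expR_sum ler_expR -mulr_sumr mulrC -ler_pdivlMr//.
apply: le_trans step _; rewrite -mulr_sumr.
rewrite exprMn -[X in _ <= X * _]expRM_natl mulr1; apply: ler_wpM2l; first exact: expR_ge0.
apply: (@le_trans _ _ (\sum_(z in pffun_on (ord0, false) (mem F) predT)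
   \prod_(j in F) x ^+ ((z : grid) j).1)).
  rewrite [leRHS]big_mkcond [leLHS]big_mkcond ler_sum// => z _; rewrite /net.
  case: ifP => [/andP[-> _]//|_]; case: ifP => // _.
  by apply: prodr_ge0 => j _; rewrite exprn_ge0// ltW.
rewrite -(big_distr_big (ord0, false) (mem F) predT
  (fun j (vs : 'I_(Num.truncn net_radius).+1 * bool) => x ^+ vs.1))/=.
rewrite prodr_const; apply: lerXn2r; rewrite ?nnegrE.
- by apply: sumr_ge0 => vs _; rewrite exprn_ge0// ltW.
- by rewrite !mulr_ge0 ?invr_ge0// ltW.
(* In one coordinate the sign gives a factor 2 and the magnitudes a geometric sum, below
   [1 / (1 - x) = (1 + eps) / eps]. *)
rewrite -(pair_bigA _ (fun (v : 'I_(Num.truncn net_radius).+1) (s : bool) => x ^+ v))/=.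
under eq_bigr do rewrite sumr_const card_bool.
rewrite sumrMnl -[leLHS]mulr_natl -mulrA ler_wpM2l//.
have := subrX1 x (Num.truncn net_radius).+1.
set S := \sum_(i < _) _ => Sx.
have <- : (1 - x)^-1 = (1 + eps) / eps.
  by rewrite /x; field; rewrite !gt_eqF//= addrAC subrr add0r.
rewrite -[leRHS]mulr1 ler_pdivlMl ?subr_gt0//.
by rewrite -opprB mulNr -Sx opprB gerBl exprn_ge0// ltW.
Qed.

(** Rounding towards 0 shrinks every coordinate, so the norm stays at most 1. Each of the [k]
    coordinates in [F] moves by at most [h = eps / sqrt k], so the total error is at most [eps]. *)
Lemma net_approx (b : 'I_p -> R) : norm2 b = 1 -> (forall j, j \notin F -> b j = 0) ->
  exists2 z, net z & norm2 (net_point z) <= 1 /\ norm2 (fun j => b j - net_point z j) <= eps.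
Proof.
move=> b1 bF; pose s := Num.sqrt (#|F|%:R : R).
have s0 : 0 < s by rewrite sqrtr_gt0 ltr0n.
have ss : s ^+ 2 = #|F|%:R by rewrite sqr_sqrtr.
pose h := eps / s; have h0 : 0 < h by rewrite divr_gt0.
pose v j := Num.truncn (`|b j| / h).
have vb j : h * (v j)%:R <= `|b j| < h * (v j)%:R + h.
  have /truncn_itv : 0 <= `|b j| / h by rewrite divr_ge0// ltW.
  by rewrite -/(v j) ler_pdivlMr// ltr_pdivrMr// -natr1 mulrDl mul1r mulrC.
have v_sum : \sum_(j in F) (v j)%:R <= net_radius.
  (* Cauchy-Schwarz against the constant 1; dividing by the mesh gives [s / h = k / eps], the net
     radius. *)
  have l1 : \sum_(j in F) `|b j| <= s.
    apply: le_trans (ler_norm _) _.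
    rewrite -[leRHS]ger0_norm ?(ltW s0)// -(ler_pXn2r (n := 2)) ?nnegrE//.
    rewrite !real_normK ?num_real// ss.
    have := cauchy_schwarz (mem F) (fun=> 1) (fun j => `|b j|).
    under eq_bigr do rewrite mul1r; move/le_trans; apply.
    under eq_bigr do rewrite expr1n; rewrite sumr_const.
    rewrite -[leRHS]mulr1 ler_wpM2l// -[leRHS](expr1n _ 2) -b1 norm2_sqr.
    under eq_bigr do rewrite real_normK ?num_real//.
    rewrite [leRHS](bigID (mem F))/= lerDl; apply: sumr_ge0 => j _; exact: sqr_ge0.
  rewrite -(ler_pM2l h0) mulr_sumr.
  apply: (@le_trans _ _ (\sum_(j in F) `|b j|)).
    by apply: ler_sum => j _; case/andP: (vb j).
  apply: le_trans l1 _; rewrite /net_radius -ss le_eqVlt; apply/orP; left.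
  by apply/eqP; rewrite /h; field; rewrite !gt_eqF.
have v_lt j : j \in F -> (v j < (Num.truncn net_radius).+1)%N.
  move=> jF; rewrite ltnS truncn_ge_nat; last by rewrite divr_ge0// ltW.
  apply: le_trans v_sum; rewrite (bigD1 j)//= lerDl.
  by apply: sumr_ge0.
pose z : grid := [ffun j => if j \in F then (inord (v j), b j < 0) else (ord0, false)].
have zE j : j \in F -> ((z j).1 = v j :> nat) /\ (z j).2 = (b j < 0).
  by move=> jF; rewrite ffunE jF/= inordK// v_lt.
have zb j : `|net_point z j| <= `|b j| /\ `|b j - net_point z j| <= h * (j \in F)%:R.
  rewrite /net_point; case: (boolP (j \in F)) => [jF|/bF->]; last first.
    by rewrite subr0 normr0 mulr0.
  have [-> ->] := zE j jF; rewrite -/s -/h mulr1.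
  have /andP[v1 v2] := vb j; have hv : 0 <= h * (v j)%:R by rewrite mulr_ge0// ltW.
  case: (ltP (b j) 0) v1 v2 => bj; rewrite ?expr1 ?expr0 ?mulN1r ?mul1r ?mulrN.
    rewrite ltr0_norm// normrN ger0_norm// opprK => v1 v2; split => //.
    by rewrite ler_norml; apply/andP; split; lra.
  rewrite !(@ger0_norm _ (b j))// ger0_norm// => v1 v2; split => //.
  by rewrite ler_norml; apply/andP; split; lra.
exists z; last split.
- apply/andP; split.
    apply/pffun_onP; split => // .
    apply/supportP => j jF; by rewrite ffunE (negbTE jF).
  by rewrite (eq_bigr (fun j => (v j)%:R))// => j /zE[-> _].
- by rewrite -b1; apply: le_norm2 => j; case: (zb j).
- rewrite -[leRHS]ger0_norm ?(ltW eps0)// -sqrtr_sqr ler_wsqrtr//.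
  apply: (@le_trans _ _ (\sum_(j < p) h ^+ 2 * (j \in F)%:R)).
    apply: ler_sum => j _; have [_ /(lerXn2r 2)] := zb j.
    rewrite !nnegrE normr_ge0 mulr_ge0 ?(ltW h0)// => /(_ isT isT).
    by rewrite real_normK ?num_real// exprMn; case: (j \in F); rewrite ?expr1n ?expr0n.
  rewrite -mulr_sumr -natr_sum -big_mkcond/= sum1_card -ss /h.
  by rewrite expr_div_n divfK// gt_eqF// exprn_gt0.
Qed.

End net.

(** * From a net to a whole subspace, for a bounded seminorm *)

Section net_to_sphere.
Context (R : realType) (p : nat) (S : set ('I_p -> R)) (g : ('I_p -> R) -> R).
Hypotheses (SB : forall a b, S a -> S b -> S (fun j => a j - b j))
  (SZ : forall c a, S a -> S (fun j => c * a j)).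
Hypotheses (gD : forall a b, g (fun j => a j + b j) <= g a + g b)
  (gZ : forall c a, g (fun j => c * a j) = `|c| * g a)
  (g_bounded : exists C, forall b, g b <= C * norm2 b).

Let g_ge0 a : 0 <= g a.
Proof.
have := gD a (fun j => -1 * a j); rewrite gZ normrN1 mul1r.
rewrite (_ : (fun j => _) = fun j => 0 * a j); last by apply/funext => j; ring.
by rewrite gZ normr0 mul0r -mulr2n pmulrn_lge0.
Qed.

(** With [A] the norm of [g] on [S] and [eps = delta / 12], approximation gives
    [A <= 1 + 3 delta / 4 + A eps], hence [A <= 1 + delta]. Below, [g] is at least [(1 - 3 delta /
    4) (1 - eps) - A eps >= 1 - delta] on unit vectors. *)
Lemma net_to_sphere (delta : R) : 0 < delta < 1 ->
  (forall b, S b -> norm2 b = 1 -> exists b', [/\ S b', norm2 b' <= 1,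
     norm2 (fun j => b j - b' j) <= delta / 12 &
     (1 - 3 / 4 * delta) * norm2 b' <= g b' <= (1 + 3 / 4 * delta) * norm2 b']) ->
  forall b, S b -> (1 - delta) * norm2 b <= g b <= (1 + delta) * norm2 b.
Proof.
move=> /andP[d0 d1] H; pose eps := delta / 12.
(* Homogeneity reduces to unit vectors; vectors of norm 0 are covered by boundedness of [g]. *)
have scale M : (forall b, S b -> norm2 b = 1 -> g b <= M) ->
    forall b, S b -> g b <= M * norm2 b.
  move=> HM b Sb; have [b0|b0] := eqVneq (norm2 b) 0.
    by case: g_bounded => C /(_ b); rewrite b0 !mulr0.
  have bgt : 0 < norm2 b by rewrite lt0r b0 norm2_ge0.
  rewrite -ler_pdivrMr//.
  have := HM _ (SZ (norm2 b)^-1 Sb); rewrite gZ norm2Z gtr0_norm ?invr_gt0//.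
  by rewrite mulVf// mulrC; apply.
(* [inf E] is the norm of g on S; the net hypothesis bounds it in terms of itself. *)
pose E := [set M | 0 <= M /\ forall b, S b -> g b <= M * norm2 b].
have Elb : has_lbound E by exists 0 => M [].
have E0 : E !=set0.
  case: g_bounded => C gC; exists `|C|; split => // b Sb.
  by apply: le_trans (gC b) _; rewrite ler_wpM2r ?norm2_ge0// ler_norm.
have infE0 : 0 <= inf E by apply: lb_le_inf => // M [].
have infE b : S b -> g b <= inf E * norm2 b.
  apply: scale => {}b Sb b1; apply: lb_le_inf => // M [_ /(_ b Sb)].
  by rewrite b1 mulr1.
have split_g b b' : g b <= g b' + g (fun j => b j - b' j).
  apply: le_trans (gD _ _); rewrite le_eqVlt; apply/orP; left; apply/eqP.
  by congr g; apply/funext => j; ring.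
have Ele : inf E <= (1 + 3 / 4 * delta) + inf E * eps.
  apply: ge_inf => //; split.
    by rewrite !addr_ge0 ?mulr_ge0 ?divr_ge0 ?(ltW d0).
  apply: scale => b Sb b1; have [b' [Sb' b'1 bb' /andP[_ gb']]] := H b Sb b1.
  apply: le_trans (split_g b b') _; apply: lerD.
    apply: le_trans gb' _; rewrite ler_piMr//.
    by rewrite addr_ge0// mulr_ge0 ?divr_ge0 ?(ltW d0).
  apply: le_trans (infE _ (SB Sb Sb')) _.
  by rewrite ler_wpM2l.
have Ed : inf E <= 1 + delta by rewrite /eps in Ele; nra.
move=> b Sb; apply/andP; split; last first.
  by apply: le_trans (infE b Sb) _; rewrite ler_wpM2r ?norm2_ge0.
have [b0|b0] := eqVneq (norm2 b) 0; first by rewrite b0 mulr0.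
have bgt : 0 < norm2 b by rewrite lt0r b0 norm2_ge0.
rewrite -ler_pdivlMr//.
have := SZ (norm2 b)^-1 Sb; set u := (fun j => _) => Su.
have u1 : norm2 u = 1 by rewrite norm2Z gtr0_norm ?invr_gt0// mulVf.
have -> : g b / norm2 b = g u by rewrite gZ gtr0_norm ?invr_gt0// mulrC.
have [b' [Sb' b'1 bb' /andP[gb' _]]] := H u Su u1.
have b'ge : 1 - eps <= norm2 b'.
  have := norm2D b' (fun j => u j - b' j).
  rewrite (_ : (fun j => _) = u); last by apply/funext => j; rewrite addrC subrK.
  by rewrite u1 -lerBlDr; apply: le_trans; rewrite lerB.
have := split_g b' u.
have := infE _ (SB Sb' Su).
have -> : norm2 (fun j => b' j - u j) = norm2 (fun j => u j - b' j).
  rewrite -[RHS]mul1r -(normrN1 R) -norm2Z; congr norm2.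
  by apply/funext => j; ring.
move: bb' Ed infE0 gb' b'ge; rewrite -/eps.
set x := norm2 _; set y := norm2 _; set G := g _; set A := inf E.
have x0 : 0 <= x by exact: norm2_ge0.
have : eps = delta / 12 by [].
move: (g _) => G'; move=> ->.
nra.
Qed.

End net_to_sphere.

(** * The union bound over the net of one support *)

Lemma measure_bigsetU_le d (T : measurableType d) (R : realType)
    (P : {measure set T -> \bar R}) (I : Type) (r : seq I) (Q : pred I) (A : I -> set T) :
  (forall i, Q i -> measurable (A i)) ->
  (P (\big[setU/set0]_(i <- r | Q i) A i) <= \sum_(i <- r | Q i) P (A i))%E.
Proof.
move=> mA; elim: r => [|i r IH]; first by rewrite !big_nil measure0.
rewrite !big_cons; case: ifP => // Qi.
apply: le_trans (measureU2 _ (mA i Qi) _) _; last exact: leeD2l.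
exact: bigsetU_measurable.
Qed.

Lemma pow2neg_ge0 (R : realType) (x : \bar R) : 0 <= pow2neg x.
Proof. by case: x => //= r; exact: powR_ge0. Qed.

(** With [D = 1 + 8 / delta >= 9] and [L = ln D], the base is at most
    [6 + 72 / delta <= 9 D <= exp(2 L)], and the exponent is at least
    [9/4 (ln 3 + t + s L) >= ln 3 + t + 2 s L]. As [k + r <= s], a factor [exp(- 2 r L) <= 2^(- r)]
    remains. *)
Lemma net_exponent_bound (R : realType) (k n : nat) (r s t delta : R) :
  0 <= r -> k%:R + r <= s -> 0 < t -> 0 < delta < 1 ->
  8 / delta ^+ 2 * (ln 3 + t + s * ln (1 + 8 / delta)) <= n%:R ->
  (expR 1 * (2 * (1 + delta / 12) / (delta / 12))) ^+ k *
    (2 * expR (- (n%:R * (3 / 4 * delta) ^+ 2 / 2))) <=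
  expR (- t) * 2 `^ (- r).
Proof.
move=> r0 krs t0 /andP[d0 d1] hn.
set D := 1 + 8 / delta in hn *; pose L := ln D.
have D9 : 9 <= D.
  by rewrite /D -lerBlDl ler_pdivlMr//; lra.
have D0 : 0 < D by lra.
have L0 : 0 < L by rewrite ln_gt0//; lra.
have DE : expR L = D by rewrite lnK.
have l3 : 0 < ln 3 :> R by rewrite ln_gt0//; lra.
have L2 : ln 2 <= L by rewrite ler_ln ?posrE//; lra.
have base : expR 1 * (2 * (1 + delta / 12) / (delta / 12)) <= expR (2 * L).
  apply: (@le_trans _ _ (9 * D)); last first.
    by rewrite [in leRHS]mulr_natl mulr2n expRD DE ler_wpM2r// ltW.
  apply: (@le_trans _ _ (3 * (2 * (1 + delta / 12) / (delta / 12)))).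
    apply: ler_wpM2r (expR1_le3 R); rewrite divr_ge0 ?mulr_ge0//; lra.
  rewrite [leLHS](_ : _ = 6 + 72 / delta); last by field; rewrite gt_eqF.
  rewrite /D mulrDr mulr1 mulrA lerD//; [lra|].
  by rewrite ler_pM2r ?invr_gt0//; lra.
have s0 : 0 <= s by apply: le_trans krs; rewrite addr_ge0.
have hexp : ln 3 + t + 2 * s * L <= n%:R * (3 / 4 * delta) ^+ 2 / 2.
  move: hn; rewrite mulrAC ler_pdivrMr ?exprn_gt0// -/L => hn.
  have sL : 0 <= s * L by rewrite mulr_ge0// ltW.
  rewrite exprMn; set q := n%:R * delta ^+ 2 in hn.
  rewrite [leRHS](_ : _ = 9 / 32 * q); last by rewrite /q; field.
  lra.
apply: (@le_trans _ _ (expR (k%:R * (2 * L)) * (2 * expR (- (ln 3 + t + 2 * s * L))))).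
  apply: ler_pM.
  - by rewrite exprn_ge0// mulr_ge0 ?expR_ge0// divr_ge0 ?mulr_ge0//; lra.
  - by rewrite mulr_ge0// expR_ge0.
  - rewrite expRM_natl lerXn2r ?nnegrE ?expR_ge0//.
    by rewrite mulr_ge0 ?expR_ge0// divr_ge0 ?mulr_ge0//; lra.
  - by rewrite ler_wpM2l// ler_expR lerN2.
rewrite /powR pnatr_eq0/= -expRD mulrCA -expRD.
(* The [ln 3] in the sample size pays for the factor 2 of the two-sided tail. *)
have -> : expR (- t + - r * ln 2) = 3 * expR (- t + - r * ln 2 - ln 3).
  rewrite [in RHS]expRD (expRN (ln 3)) lnK ?posrE// [RHS]mulrCA divff ?mulr1// pnatr_eq0//.
apply: ler_pM => //; rewrite ?expR_ge0 ?ler_nat// ler_expR.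
have : (k%:R + r) * L <= s * L by rewrite ler_wpM2r// ltW.
have : r * ln 2 <= r * L by rewrite ler_wpM2l.
have : 0 <= r * L by rewrite mulr_ge0// ltW.
nra.
Qed.

Section union_bound.
Context d (T : measurableType d) (R : realType) (P : probability T R).
Variables (n p : nat) (X : 'I_n * 'I_p -> {RV P >-> R}).
Hypotheses (Xindep : mutually_independent X) (Xgauss : forall k, std_gaussian (X k)).
Variable delta : R.

(** Net points of norm 0 are left out because the tail bound normalizes by [norm2 b]. *)
Definition net_failure (F : {set 'I_p}) : set T :=
  \big[setU/set0]_(z : grid F (delta / 12) | net z && (0 < norm2 (net_point z)))
    [set w | distorts X (net_point z) (3 / 4 * delta) w].

Lemma net_failure_measurable (F : {set 'I_p}) : measurable (net_failure F).
Proof. by apply: bigsetU_measurable => z _; exact: distorts_measurable. Qed.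

Lemma net_failure_le (F : {set 'I_p}) : (0 < #|F|)%N -> 0 < delta < 1 ->
  (P (net_failure F) <=
   ((expR 1 * (2 * (1 + delta / 12) / (delta / 12))) ^+ #|F| *
    (2 * expR (- (n%:R * (3 / 4 * delta) ^+ 2 / 2))))%:E)%E.
Proof.
move=> F0 /andP[d0 d1].
apply: le_trans (measure_bigsetU_le P _ _) _ => [z _|].
  exact: distorts_measurable.
set e := 2 * expR _; have e0 : 0 <= e by rewrite mulr_ge0// expR_ge0.
apply: (@le_trans _ _ (\sum_(z : grid F (delta / 12) | net z) e%:E)%E).
  rewrite big_mkcondr/=; apply: lee_sum => z _; case: ifP => z0; last by rewrite lee_fin.
  by apply: distorts_tail => //; apply/andP; split; lra.
rewrite sumEFin lee_fin sumr_const -[leLHS]mulr_natl ler_wpM2r//.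
by apply: card_net => //; rewrite divr_gt0.
Qed.

(** Deterministic in [w]: the net argument is applied to the vectors supported in [F] and the
    seminorm [norm2 (X b) / sqrt n]. *)
Lemma isometry_off_net_failure (F : {set 'I_p}) (w : T) :
  (0 < n)%N -> (0 < #|F|)%N -> 0 < delta < 1 -> ~ net_failure F w ->
  forall b : 'I_p -> R, (forall j, j \notin F -> b j = 0) ->
  (1 - delta) * norm2 b
    <= (Num.sqrt n%:R)^-1 * norm2 (matvec (fun i j => X (i, j) w) b)
    <= (1 + delta) * norm2 b.
Proof.
move=> n0 F0 /andP[d0 d1] notbad; set M := fun i j => X (i, j) w.
have sn0 : 0 < Num.sqrt n%:R :> R by rewrite sqrtr_gt0 ltr0n.
apply: (net_to_sphere (S := [set b | forall j, j \notin F -> b j = 0])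
  (g := fun b => (Num.sqrt n%:R)^-1 * norm2 (matvec M b))).
- by move=> a b aF bF j jF; rewrite aF// bF// subr0.
- by move=> c a aF j jF; rewrite aF// mulr0.
- move=> a b; rewrite -mulrDr ler_pM2l ?invr_gt0//.
  rewrite (_ : matvec M _ = fun i => matvec M a i + matvec M b i); first exact: norm2D.
  by apply/funext => i; rewrite /matvec -big_split; apply: eq_bigr => j _; rewrite mulrDr.
- move=> c a; rewrite (_ : matvec M _ = fun i => c * matvec M a i).
    by rewrite norm2Z mulrCA.
  by apply/funext => i; rewrite /matvec mulr_sumr; apply: eq_bigr => j _; rewrite mulrCA.
- exists ((Num.sqrt n%:R)^-1 * Num.sqrt (\sum_i \sum_j M i j ^+ 2)) => b.
  by rewrite -mulrA ler_pM2l ?invr_gt0// norm2_matvec_le.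
- by rewrite d0.
move=> b bF b1; have e0 : 0 < delta / 12 by rewrite divr_gt0.
have [z zN [z1 bz]] := net_approx e0 F0 b1 bF.
exists (net_point z); split => //.
  by move=> j jF; rewrite /net_point (negbTE jF).
rewrite -(mulrC (norm2 (matvec M _))) ler_pdivlMr// ler_pdivrMr//.
(* A net point of norm 0 satisfies both bounds trivially, since its image also has norm 0. *)
have [z0|z0] := ltP 0 (norm2 (net_point z)); last first.
  have {}z0 : norm2 (net_point z) = 0 by apply/eqP; rewrite eq_le z0 norm2_ge0.
  have := norm2_matvec_le M (net_point z); rewrite z0 !mulr0 !mul0r => ->.
  by rewrite norm2_ge0.
have : ~ distorts X (net_point z) (3 / 4 * delta) w.
  move=> bad; apply: notbad; rewrite /net_failure -bigcup_seq_cond.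
  by exists z => //=; rewrite mem_index_enum zN z0.
rewrite /distorts => /not_orP[/negP + /negP]; rewrite -!leNgt => lo hi.
by rewrite !(mulrAC _ (norm2 _)) lo hi.
Qed.

End union_bound.

(** * Coding complexity and the uniform estimate over all supports *)

(** By contraposition: if [s] is strictly below every term and below the default [+oo], it is
    strictly below their finite minimum. *)
Lemma cc_vec_le (R : realType) (p : nat) (cl : {set 'I_p} -> \bar R) (b : 'I_p -> R) (s : R) :
  (cc_vec cl b <= s%:E)%E ->
  exists2 F : {set 'I_p}, supp b \subset F & (cc_set cl F <= s%:E)%E.
Proof.
move=> h; apply: contrapT => noF; move: h; apply/negP; rewrite -ltNge.
rewrite /cc_vec; apply: (big_ind (fun x => (s%:E < x)%E)) => [|x y sx sy|F bF]; first exact: ltry.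
  by rewrite lt_min sx sy.
by rewrite ltNge; apply/negP => Fs; apply: noF; exists F.
Qed.

Theorem theorem1 (R : realType) (d : measure_display) (T : measurableType d)
  (P : probability T R) (n p : nat) (cl : {set 'I_p} -> \bar R)
  (X : 'I_n * 'I_p -> {RV P >-> R}) (s t delta : R) :
  coding_length cl ->
  mutually_independent X ->
  (forall k, std_gaussian (X k)) ->
  0 < s -> 0 < t -> 0 < delta < 1 ->
  8 / delta ^+ 2 * (ln 3 + t + s * ln (1 + 8 / delta)) <= n%:R ->
  exists E : set T, measurable E /\
    (P E >= (1 - expR (- t))%:E)%E /\
    (forall w, E w ->
      forall b : 'I_p -> R, (cc_vec cl b <= s%:E)%E ->
        (1 - delta) * norm2 b
          <= (Num.sqrt n%:R)^-1 * norm2 (matvec (fun i j => X (i, j) w) b)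
        /\ (Num.sqrt n%:R)^-1 * norm2 (matvec (fun i j => X (i, j) w) b)
          <= (1 + delta) * norm2 b).
Proof.
move=> [cl0 [_ cl1]] Xindep Xgauss s0 t0 d01 hn.
(* The sample size condition has a positive left side, so [sqrt n] is invertible. *)
have n0 : (0 < n)%N.
  rewrite -(ltr0n R); apply: lt_le_trans hn; case/andP: d01 => d0 d1.
  have e0 : 0 < 8 / delta by rewrite divr_gt0.
  rewrite mulr_gt0 ?divr_gt0 ?exprn_gt0// !addr_gt0 ?mulr_gt0 ?ln_gt0//; lra.
pose small (F : {set 'I_p}) := (F != finset.set0) && (cc_set cl F <= s%:E)%E.
pose B := \big[setU/set0]_(F : {set 'I_p} | small F) net_failure X delta F.
have mB : measurable B by apply: bigsetU_measurable => F _; exact: net_failure_measurable.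
have PB : (P B <= (expR (- t))%:E)%E.
  apply: le_trans (measure_bigsetU_le P _ _) _ => [F _|].
    exact: net_failure_measurable.
  apply: (@le_trans _ _
    (\sum_(F : {set 'I_p} | F != finset.set0) (expR (- t) * pow2neg (cl F))%:E)%E).
    rewrite big_mkcondr/=; apply: lee_sum => F F0.
    case: ifP => [Fs|_]; last by rewrite lee_fin mulr_ge0 ?expR_ge0 ?pow2neg_ge0.
    have cF : (0 < #|F|)%N by rewrite card_gt0.
    apply: le_trans (net_failure_le Xindep Xgauss cF d01) _.
    rewrite lee_fin; have := cl0 F; move: Fs; rewrite /cc_set.
    (* Complexity at most [s] forces [cl F] to be a finite [r] with [k + r <= s]. *)
    case: (cl F) => [r| |]//=; rewrite ?lee_fin// => Fs r0.
    exact: (@net_exponent_bound _ _ _ _ s).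
  (* The Kraft-type inequality of a coding length sums the failure probabilities to at most
     [exp(- t)]. *)
  rewrite sumEFin lee_fin -mulr_sumr ler_piMr// expR_ge0.
exists (~` B); split; first exact: measurableC.
split; first by rewrite probability_setC// EFinB leeB.
move=> w Bw b /cc_vec_le[F bF Fs].
have b0 j : j \notin F -> b j = 0.
  move=> jF; apply/eqP; apply: contraNT jF => bj; apply: (fintype.subsetP bF).
  by rewrite inE.
(* The empty support has no net and lies outside the coding sum; there [b = 0] and all terms
   vanish. *)
have [F0|F0] := eqVneq F finset.set0.
  have b00 : norm2 b = 0.
    rewrite /norm2 big1 ?sqrtr0// => j _; rewrite b0 ?expr0n// F0 inE//.
  have := norm2_matvec_le (fun i j => X (i, j) w) b.
  rewrite b00 !mulr0 => le0.
  have -> : norm2 (matvec (fun i j => X (i, j) w) b) = 0.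
    by apply/eqP; rewrite eq_le le0 norm2_ge0.
  by rewrite mulr0.
have cF : (0 < #|F|)%N by rewrite card_gt0.
have notbad : ~ net_failure X delta F w.
  move=> bad; apply: Bw; rewrite /B -bigcup_seq_cond.
  by exists F => //=; rewrite mem_index_enum /small F0 Fs.
by have /andP[] := isometry_off_net_failure n0 cF d01 notbad b0.
Qed.
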